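(* Let $d \in \mathfrak{F}$ be any bounded function which is not identically equal to zero. Then $\mathcal{B}_d = \mathcal{A}$. In particular, for any function $f \in \mathfrak{F}$, if the class $\mathcal{B}_f$ contains a non-automatic group, then $f$ must be unbounded.
   Context: All groups considered are finitely generated and infinite. $\mathbb{N}$ is the set of positive integers and $\mathbb{R}^{+}$ the set of non-negative reals. Notation. For a finite generating set $A \subseteq G$ of a group $G$, put $S = A \cup A^{-1}$. $d_A(g_1,g_2)$ denotes the distance between $g_1,g_2\in G$ in the Cayley graph $\Gamma(G,A)$. $\pi : S^* \to G$ is the canonical map sending a word to the group element it represents. Regular relations. For a finite alphabet $\Sigma$ and a padding symbol $\diamond \notin \Sigma$, the convolution $w_1 \otimes w_2$ of $w_1,w_2\in\Sigma^*$ is the string of length $\max\{|w_1|,|w_2|\}$ over $(\Sigma\cup\{\diamond\})^2$ whose $k$th symbol is $(\sigma_1,\sigma_2)$, where $\sigma_i$ is the $k$th symbol of $w_i$ if $k \leqslant |w_i|$ and $\diamond$ otherwise. A binary relation $R \subseteq \Sigma^*\times\Sigma^*$ is regular if $\{w_1\otimes w_2 : (w_1,w_2)\in R\}$ is a regular language (accepted by a finite automaton over $(\Sigma\cup\{\diamond\})^2\setminus\{(\diamond,\diamond)\}$). Cayley automatic representation. A Cayley automatic representation of $G$ (with respect to $A$) is a bijection $\psi: L \to G$, where $L\subseteq S^*$ is a regular language, such that for every $a\in A$ the relation $\{(\psi^{-1}(g),\psi^{-1}(ga)) : g\in G\}\subseteq L\times L$ is regular. $G$ is Cayley automatic if it has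 such a representation. $G$ is automatic if it has such a representation with $\psi = \pi|_L$. $\mathcal{A}$ denotes the class of all automatic groups. Functions. $\mathfrak{F}$ is the set of all functions $f:[Q,+\infty)\to\mathbb{R}^{+}$, where $[Q,+\infty)\subseteq\mathbb{N}$ is the set of all integers $\geqslant Q$ for some $Q\in\mathbb{N}$ (depending on $f$), with $f(n)\leqslant f(n+1)$ for all $n\in\mathrm{dom}\, f$. For $f,h\in\mathfrak{F}$, write $h\preceq f$ if there exist positive integers $K,M,N$ such that $[N,+\infty)\subseteq \mathrm{dom}\,h\cap\mathrm{dom}\,f$ and $h(n)\leqslant K f(Mn)$ for every integer $n\geqslant N$. The class $\mathcal{B}_f$. For $f\in\mathfrak{F}$, $\mathcal{B}_f$ is the class of all Cayley automatic groups $G$ for which there exist (for a chosen finite generating set $A$; the property does not depend on this choice) a regular language $L\subseteq S^*$ and a Cayley automatic representation $\psi: L\to G$ such that the function $h(n)=\max\{d_A(\pi(w),\psi(w)) : w\in L,\ |w|\leqslant n\}$ (defined for all $n$ for which $L$ contains a word of length at most $n$) satisfies $h\preceq f$. *)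

(* Defs.v *)
From HB Require Import structures.
From mathcomp Require Import all_boot all_order all_algebra.
From mathcomp Require Import boolp classical_sets functions cardinality reals.

Set Implicit Arguments.
Unset Strict Implicit.
Unset Printing Implicit Defensive.

Import Order.TTheory GRing.Theory Num.Theory.
Local Open Scope classical_set_scope.
Local Open Scope nat_scope.

Record dfa (T : finType) := Dfa {
  dfa_state : finType;
  dfa_init : dfa_state;
  dfa_final : pred dfa_state;
  dfa_step : dfa_state -> T -> dfa_state }.

Definition dfa_accept (T : finType) (D : dfa T) (w : seq T) : bool :=
  dfa_final (foldl (@dfa_step T D) (dfa_init D) w).

Definition regular_language (T : finType) (L : set (seq T)) : Prop :=
  exists D : dfa T, L = [set w | dfa_accept D w].

(* The padding symbol is [None]. *)
Definition convolution (T : Type) (w1 w2 : seq T) :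
    seq (option T * option T) :=
  mkseq (fun k => (onth w1 k, onth w2 k)) (maxn (size w1) (size w2)).

Definition pad_pair (T : finType) : finType :=
  {p : option T * option T | p != (None, None)}.

(* Convolutions never contain the pair (None, None), so each of them is
   [map val u] for exactly one word u over [pad_pair T]. *)
Definition regular_relation (T : finType) (R : set (seq T * seq T)) : Prop :=
  regular_language
    [set u : seq (pad_pair T) |
      exists2 p, R p & map val u = convolution p.1 p.2].

(* A finite subset A of G is given by a list.  The alphabet is the set
   A `|` A^-1: repetitions in the list are irrelevant, and elements that are
   equal in G are the same letter. *)
Definition letter (G : groupType) (A : seq G) : finType :=
  seq_sub (A ++ [seq (a^-1)%g | a <- A]).

Definition word_eval (G : groupType) (A : seq G) (w : seq (letter A)) : G :=
  (\big[*%g/1%g]_(x <- w) val x).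

Definition generates (G : groupType) (A : seq G) : Prop :=
  forall g : G, exists w : seq (letter A), word_eval w = g.

Definition finitely_generated (G : groupType) : Prop :=
  exists A : seq G, generates A.

Definition cayley_adj (G : groupType) (A : seq G) : rel G :=
  fun g h => has (fun a => (h == g * a)%g || (g == h * a)%g) A.

Definition cayley_walk (G : groupType) (A : seq G) (g h : G) (n : nat) : Prop :=
  exists p : seq G, [/\ size p = n, path (cayley_adj A) g p & last g p = h].

(* The value 0 for unconnected g, h never arises when A generates G. *)
Definition cayley_dist (G : groupType) (A : seq G) (g h : G) : nat :=
  if pselect (exists n, `[< cayley_walk A g h n >]) is left ex
  then ex_minn ex else 0.

(* psi is a total function on words of which only the restriction to L
   matters. *)
Definition cayley_automatic_rep (G : groupType) (A : seq G)
    (L : set (seq (letter A))) (psi : seq (letter A) -> G) : Prop :=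
  [/\ regular_language L,
      set_bij L [set: G] psi &
      forall a, a \in A ->
        regular_relation
          [set p : seq (letter A) * seq (letter A) |
            exists g : G, [/\ L p.1, psi p.1 = g, L p.2 & psi p.2 = (g * a)%g]]].

Definition cayley_automatic (G : groupType) : Prop :=
  exists A : seq G, generates A /\
    exists (L : set (seq (letter A))) (psi : seq (letter A) -> G),
      cayley_automatic_rep L psi.

Definition automatic (G : groupType) : Prop :=
  exists A : seq G, generates A /\
    exists L : set (seq (letter A)), cayley_automatic_rep L (@word_eval G A).

(* A partial function from the positive integers to the reals; the values of
   [pf_val] outside [pf_dom] are irrelevant. *)
Record pfun (R : realType) := Pfun {
  pf_dom : set nat;
  pf_val :> nat -> R }.

Definition in_frakF (R : realType) (f : pfun R) : Prop :=
  [/\ exists2 Q, 0 < Q & pf_dom f = [set n | Q <= n],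
      forall n, pf_dom f n -> (0 <= f n)%R &
      forall n, pf_dom f n -> (f n <= f n.+1)%R].

Definition pf_preceq (R : realType) (h f : pfun R) : Prop :=
  exists K M N : nat, [/\ 0 < K, 0 < M, 0 < N,
    [set n | N <= n] `<=` pf_dom h `&` pf_dom f &
    forall n, N <= n -> (h n <= K%:R * f (M * n)%N)%R].

Definition pf_bounded (R : realType) (f : pfun R) : Prop :=
  exists C : R, forall n, pf_dom f n -> (f n <= C)%R.

(* The maximum is over the finite type of words of length at most n. *)
Definition deviation (R : realType) (G : groupType) (A : seq G)
    (L : set (seq (letter A))) (psi : seq (letter A) -> G) : pfun R :=
  {| pf_dom := [set n | 0 < n /\ exists2 w, L w & size w <= n];
     pf_val := fun n =>
       ((\max_(w : n.-bseq (letter A) | `[< L w >])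
           cayley_dist A (word_eval w) (psi w))%N%:R)%R |}.

Lemma deviation_in_frakF (R : realType) (G : groupType) (A : seq G)
    (L : set (seq (letter A))) (psi : seq (letter A) -> G) :
  L !=set0 -> in_frakF (deviation R L psi).
Proof.
move=> [w0 Lw0].
have exn : exists n, (0 < n) && `[< exists2 w, L w & size w <= n >].
  exists (size w0).+1; apply/andP; split=> //.
  by apply/asboolP; exists w0.
split=> [|n _|n _]; last 2 first.
- exact: ler0n.
- rewrite ler_nat; apply/bigmax_leqP => w Lw.
  have wn : size w <= n.+1 by exact: leqW (size_bseq w).
  exact: (@leq_bigmax_cond _ (fun v : n.+1.-bseq _ => `[< L v >])
    (fun v => cayley_dist A (word_eval v) (psi v)) (Bseq wn)).
case: (ex_minnP exn) => Q /andP[Q0 /asboolP[w Lw wQ]] Qmin.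
exists Q => //; apply/seteqP; split => n /=.
  by move=> [n0 h]; apply: Qmin; rewrite n0; exact/asboolP.
by move=> Qn; split; [exact: leq_trans Qn|exists w => //; exact: leq_trans Qn].
Qed.

Definition class_B (R : realType) (f : pfun R) (G : groupType) : Prop :=
  cayley_automatic G /\
  exists A : seq G, generates A /\
    exists (L : set (seq (letter A))) (psi : seq (letter A) -> G),
      cayley_automatic_rep L psi /\ pf_preceq (deviation R L psi) f.

(* Main.v *)
(* Let psi be a representation on L with d_A(pi(w), psi(w)) <= C for w in L. A
   prefix of a pair (v, w) in a regular relation extends, by words of bounded
   length, to another pair of that relation; since psi(w) = psi(v) a forces
   pi(v) and pi(w) to be within 2C + 1, such v and w fellow travel under pi.
   Appending all words of length at most C to L gives a regular language that pi
   maps onto G and whose words with equal or adjacent values fellow travel. The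
   differences of their prefixes range over a finite set, hence are tracked by a
   finite automaton, and the shortlex-least representatives of the group
   elements form an automatic structure. *)
Require Import Defs.
From mathcomp Require Import all_boot all_order all_algebra.
From mathcomp Require Import boolp classical_sets functions cardinality reals.
From mathcomp Require Import zify.

Set Implicit Arguments.
Unset Strict Implicit.
Unset Printing Implicit Defensive.

Local Open Scope classical_set_scope.
Local Open Scope nat_scope.

(** * Regular languages *)

(** A Myhill-Nerode criterion: a map to a finite type that is compatible with appending a letter and
    separates [L] from its complement acts as an automaton. Later regularity proofs only have to
    name the information to be remembered. *)
Lemma regular_languageP (T : finType) (L : set (seq T)) :
  regular_language L <->
  exists (S : finType) (f : seq T -> S),
    (forall u v x, f u = f v -> f (rcons u x) = f (rcons v x)) /\
    (forall u v, f u = f v -> L u -> L v).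
Proof.
split=> [[D ->]|[S [f [fS fL]]]].
  exists (dfa_state D), (foldl (@dfa_step T D) (dfa_init D)); split=> [u v x|u v].
    by rewrite !foldl_rcons => ->.
  by rewrite /= /dfa_accept => ->.
(* The transition out of [s] is computed on a chosen word reaching [s]; at states that no word
   reaches its value is arbitrary. *)
pose step s x := if pselect (exists u, f u = s) is left ex
  then f (rcons (projT1 (cid ex)) x) else s.
exists (Dfa (f [::]) (fun s => `[< exists2 u, f u = s & L u >]) step).
have run w : foldl step (f [::]) w = f w.
  elim/last_ind: w => [//|w x IH]; rewrite foldl_rcons IH /step.
  case: pselect => [ex|[]]; last by exists w.
  by case: (cid ex) => u /= fu; exact: fS.
apply/seteqP; split=> w; rewrite /= /dfa_accept /= run.
  by move=> Lw; apply/asboolP; exists w.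
by move=> /asboolP[u fu Lu]; exact: fL Lu.
Qed.

Lemma regular_setI (T : finType) (L M : set (seq T)) :
  regular_language L -> regular_language M -> regular_language (L `&` M).
Proof.
move=> /regular_languageP[S [f [fS fL]]] /regular_languageP[S' [g [gS gM]]].
apply/regular_languageP; exists (S * S')%type, (fun u => (f u, g u)).
split=> [u v x|u v] [fuv guv].
  by rewrite (fS u v) ?(gS u v).
by case=> /(fL _ _ fuv) ? /(gM _ _ guv).
Qed.

Lemma regular_setC (T : finType) (L : set (seq T)) :
  regular_language L -> regular_language (~` L).
Proof.
move=> /regular_languageP[S [f [fS fL]]].
apply/regular_languageP; exists S, f; split=> // u v fuv nLu /(fL v u (esym fuv)).
exact: nLu.
Qed.

Lemma regular_preimage_pmap (T U : finType) (h : T -> option U)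
    (L : set (seq U)) :
  regular_language L -> regular_language [set u | L (pmap h u)].
Proof.
move=> /regular_languageP[S [f [fS fL]]].
apply/regular_languageP; exists S, (f \o pmap h).
split=> [u v x|u v] /= fuv; last exact: fL.
rewrite -!cats1 !pmap_cat /=; case: (h x) => [y|] /=; last by rewrite !cats0.
by rewrite !cats1; exact: fS.
Qed.

Lemma regular_preimage_map (T U : finType) (h : T -> U) (L : set (seq U)) :
  regular_language L -> regular_language [set u | L (map h u)].
Proof.
have -> : [set u | L (map h u)] = [set u | L (pmap (Some \o h) u)].
  by apply: eq_set => u; congr L; elim: u => //= x u ->.
exact: regular_preimage_pmap.
Qed.

(** Subset construction: the state after [v] is the set of values of [f] on all preimages of [v]. *)
Lemma regular_image_map (T U : finType) (h : T -> U) (L : set (seq T)) :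
  regular_language L -> regular_language [set map h u | u in L].
Proof.
move=> /regular_languageP[S [f [fS fL]]]; apply/regular_languageP.
pose F v := [set s : S | `[< exists2 u, map h u = v & f u = s >]]%SET.
have FP v s : reflect (exists2 u, map h u = v & f u = s) (s \in F v).
  by rewrite finset.in_set; exact: asboolP.
exists {set S}, F; split.
  have FS v w x : F v = F w -> F (rcons v x) \subset F (rcons w x).
    move=> Fvw; apply/fintype.subsetP => s /FP[u].
    case/lastP: u => [|u y]; first by case: v Fvw.
    rewrite map_rcons => /rcons_inj[uv yx] us.
    have : f u \in F v by apply/FP; exists u.
    rewrite Fvw => /FP[u' u'w fu']; apply/FP.
    exists (rcons u' y); first by rewrite map_rcons u'w yx.
    by rewrite -us; exact: fS.
  move=> v w x Fvw; apply/eqP; rewrite finset.eqEsubset.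
  by rewrite !FS.
move=> v w Fvw [u Lu uv].
have : f u \in F v by apply/FP; exists u.
by rewrite Fvw => /FP[u' u'w /esym fu']; exists u' => //; exact: fL Lu.
Qed.

Definition suffix_extension (T : Type) (n : nat) (L : set (seq T)) :
    set (seq T) :=
  [set v | exists w u, [/\ L w, size u <= n & v = w ++ u]].

Lemma regular_suffix_extension (T : finType) (n : nat) (L : set (seq T)) :
  regular_language L -> regular_language (suffix_extension n L).
Proof.
move=> regL; elim: n => [|n /regular_languageP[S [f [fS fE]]]].
  suff -> : suffix_extension 0 L = L by [].
  apply/seteqP; split=> v /=; last by move=> Lv; exists v, [::]; rewrite cats0.
  by move=> [w [u [Lw]]]; rewrite leqn0 => /nilP -> ->; rewrite cats0.
(* An empty suffix puts [rcons v x] in [L]; a nonempty one ends in [x], and dropping [x] leaves a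
   suffix of length at most [n]. *)
have ER v x : suffix_extension n.+1 L (rcons v x) <->
    (suffix_extension n L (rcons v x) \/ suffix_extension n L v).
  split=> [[w [u [Lw]]]|].
    case/lastP: u => [_|u y]; first by left; exists w, [::].
    rewrite size_rcons ltnS -rcons_cat => un /rcons_inj[-> _].
    by right; exists w, u.
  case=> [[w [u [Lw un ->]]]|[w [u [Lw un ->]]]].
    by exists w, u; split=> //; exact: leqW.
  by exists w, (rcons u x); rewrite size_rcons rcons_cat.
apply/regular_languageP.
(* The Boolean is carried along because [f (rcons v x)] need not determine whether [v] lies in the
   extension by [n] letters. *)
exists (S * bool)%type, (fun v => (f v, `[< suffix_extension n.+1 L v >])).
split=> [u v x [fuv _]|u v [_ Euv] Eu]; last first.
  by apply/asboolP; rewrite -Euv; apply/asboolP.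
have fR := fS _ _ x fuv; congr pair => //; apply: asbool_equiv_eq.
rewrite !ER; split=> -[] H.
- by left; exact: fE H.
- by right; exact: fE H.
- by left; exact: fE (esym _) H.
- by right; exact: fE (esym _) H.
Qed.

(** * Synchronous relations *)

Definition first_track (T : finType) (u : seq (pad_pair T)) : seq T :=
  pmap (fun x => (val x).1) u.

Definition second_track (T : finType) (u : seq (pad_pair T)) : seq T :=
  pmap (fun x => (val x).2) u.

(** Equivalently, on each track no letter comes after padding; an arbitrary word over [pad_pair T]
    may violate this. *)
Definition is_convolution (T : finType) (u : seq (pad_pair T)) : Prop :=
  map val u = convolution (first_track u) (second_track u).

Lemma size_convolution (T : Type) (p q : seq T) :
  size (convolution p q) = maxn (size p) (size q).
Proof. by rewrite size_mkseq. Qed.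

Lemma onth_convolution (T : Type) (p q : seq T) (k : nat) :
  k < maxn (size p) (size q) ->
  onth (convolution p q) k = Some (onth p k, onth q k).
Proof.
move=> kn; have kn' : k < size (convolution p q) by rewrite size_convolution.
rewrite onthE (nth_map (None, None)) // nth_mkseq //.
Qed.

Lemma pmap_onth (T : Type) (p : seq T) (n : nat) :
  size p <= n -> pmap id (mkseq (onth p) n) = p.
Proof.
move=> pn.
have -> : mkseq (onth p) n = map Some p ++ nseq (n - size p) None.
  apply: eq_from_onth => i; rewrite onth_cat size_map onth_map onth_nseq.
  rewrite /mkseq onth_map; case: (ltnP i n) => ni; last first.
    rewrite onth_default ?size_iota //= ltnNge (leq_trans pn) //=.
    by case: ltnP => // ?; lia.
  rewrite (onthE (iota _ _)) (nth_map 0) ?size_iota // nth_iota //= add0n.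
  case: ltnP => ip; last by rewrite onth_default //; case: ltnP => //; lia.
  by have := onthTE p i; rewrite ip; case: (onth p i).
rewrite pmap_cat [X in _ ++ X](_ : _ = [::]); last by elim: (n - _).
by rewrite cats0 map_pK.
Qed.

Lemma convolution_tracks (T : finType) (u : seq (pad_pair T)) (p q : seq T) :
  map val u = convolution p q -> first_track u = p /\ second_track u = q.
Proof.
move=> uE; split.
  have -> : first_track u = pmap fst (map val u) by elim: u {uE} => //= x u ->.
  rewrite uE -[RHS](@pmap_onth _ p (maxn (size p) (size q))) ?leq_maxl //.
  by rewrite /convolution /mkseq; elim: (iota _ _) => //= i s ->.
have -> : second_track u = pmap snd (map val u) by elim: u {uE} => //= x u ->.
rewrite uE -[RHS](@pmap_onth _ q (maxn (size p) (size q))) ?leq_maxr //.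
by rewrite /convolution /mkseq; elim: (iota _ _) => //= i s ->.
Qed.

Lemma convolution_exists (T : finType) (p q : seq T) :
  exists u : seq (pad_pair T), map val u = convolution p q.
Proof.
have cP : all (fun x => x != (None, None)) (convolution p q).
  apply/allP => x /mapP[k]; rewrite mem_iota add0n /= => kn ->.
  apply/negP => /eqP[pk qk]; have := onthTE p k; have := onthTE q k.
  by rewrite pk qk /=; lia.
exists (pmap insub (convolution p q)).
rewrite (pmap_filter (@insubK _ _ _)); apply/all_filterP.
by apply: sub_all cP => x xN; rewrite isSome_insub.
Qed.

(** The tracks recover the pair from its convolution, which removes the existential quantifier. *)
Lemma regular_relationE (T : finType) (R : set (seq T * seq T)) :
  regular_relation R <->
  regular_language [set u : seq (pad_pair T) |
    is_convolution u /\ R (first_track u, second_track u)].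
Proof.
rewrite /regular_relation.
rewrite (_ : [set u | exists2 p, R p & map val u = convolution p.1 p.2] =
  [set u | is_convolution u /\ R (first_track u, second_track u)]) //.
apply/seteqP; split=> u /=.
  move=> [[p q] Rpq] /= uE; have [up uq] := convolution_tracks uE.
  by rewrite /is_convolution up uq.
by move=> [uE Ru]; exists (first_track u, second_track u).
Qed.

Lemma first_track_rcons (T : finType) (u : seq (pad_pair T)) x :
  first_track (rcons u x) = first_track u ++ seq_of_opt (val x).1.
Proof. by rewrite /first_track -cats1 pmap_cat /=; case: (val x).1. Qed.

Lemma second_track_rcons (T : finType) (u : seq (pad_pair T)) x :
  second_track (rcons u x) = second_track u ++ seq_of_opt (val x).2.
Proof. by rewrite /second_track -cats1 pmap_cat /=; case: (val x).2. Qed.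

Lemma size_first_track (T : finType) (u : seq (pad_pair T)) :
  size (first_track u) <= size u.
Proof. by rewrite size_pmap count_size. Qed.

Lemma size_second_track (T : finType) (u : seq (pad_pair T)) :
  size (second_track u) <= size u.
Proof. by rewrite size_pmap count_size. Qed.

Lemma size_is_convolution (T : finType) (u : seq (pad_pair T)) :
  is_convolution u -> size u = maxn (size (first_track u)) (size (second_track u)).
Proof. by rewrite -size_convolution => <-; rewrite size_map. Qed.

Lemma onth_cat_opt (T : Type) (p : seq T) (o : option T) (n k : nat) :
  (o -> size p = n) -> k < n -> onth (p ++ seq_of_opt o) k = onth p k.
Proof.
by case: o => [a|] /= pn kn; rewrite ?cats0 // onth_cat pn ?kn.
Qed.

Lemma onth_cat_opt_last (T : Type) (p : seq T) (o : option T) (n : nat) :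
  (o -> size p = n) -> size p <= n -> onth (p ++ seq_of_opt o) n = o.
Proof.
case: o => [a|] /= pn le_pn; last by rewrite cats0 onth_default.
by rewrite onth_cat pn // ltnn subnn.
Qed.

Lemma take_cat_opt (T : Type) (p : seq T) (o : option T) (n k : nat) :
  (o -> size p = n) -> k <= n -> take k (p ++ seq_of_opt o) = take k p.
Proof.
by case: o => [a|] /= pn kn; rewrite ?cats0 // takel_cat // pn.
Qed.

(** A track accepts a further letter only while it contains no padding, that is, while it is as long
    as [u]. *)
Lemma is_convolution_rcons (T : finType) (u : seq (pad_pair T)) x :
  is_convolution (rcons u x) <->
  [/\ is_convolution u, (val x).1 -> size (first_track u) = size u &
      (val x).2 -> size (second_track u) = size u].
Proof.
have pu := size_first_track u; have qu := size_second_track u.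
have szo (o : option T) : size (seq_of_opt o) = o by case: o.
have xN : (val x).1 || (val x).2 by case: x => -[[a|] [b|]].
have glue : ((val x).1 -> size (first_track u) = size u) ->
    ((val x).2 -> size (second_track u) = size u) ->
    maxn (size (first_track (rcons u x))) (size (second_track (rcons u x)))
      = (size u).+1 ->
    maxn (size (first_track u)) (size (second_track u)) = size u /\
    convolution (first_track (rcons u x)) (second_track (rcons u x)) =
    rcons (mkseq (fun k => (onth (first_track u) k, onth (second_track u) k))
      (size u)) (val x).
  move=> p1 p2 szE; split.
    by case/orP: xN => [/p1 pE|/p2 qE]; lia.
  rewrite /convolution szE mkseqS first_track_rcons second_track_rcons.
  rewrite !onth_cat_opt_last // -surjective_pairing; congr rcons.
  apply/eq_in_map => k; rewrite mem_iota add0n => /= kn.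
  by rewrite !(onth_cat_opt (n := size u)).
split=> [cux|[cu p1 p2]].
  have := size_is_convolution cux; rewrite size_rcons => szE.
  have xE : val x = (onth (first_track (rcons u x)) (size u),
                     onth (second_track (rcons u x)) (size u)).
    have := congr1 (fun s => onth s (size u)) cux.
    rewrite onth_convolution -?szE // map_rcons -cats1 onth_cat size_map ltnn.
    by rewrite subnn /= => -[].
  have p1 : (val x).1 -> size (first_track u) = size u.
    move=> x1; have := onthTE (first_track (rcons u x)) (size u).
    have -> : onth (first_track (rcons u x)) (size u) = (val x).1.
      exact: esym (congr1 fst xE).
    by rewrite first_track_rcons size_cat szo x1; lia.
  have p2 : (val x).2 -> size (second_track u) = size u.
    move=> x2; have := onthTE (second_track (rcons u x)) (size u).
    have -> : onth (second_track (rcons u x)) (size u) = (val x).2.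
      exact: esym (congr1 snd xE).
    by rewrite second_track_rcons size_cat szo x2; lia.
  have [szu cE] := glue p1 p2 (esym szE); split=> //.
  move: cux; rewrite /is_convolution cE map_rcons => /rcons_inj[->].
  by rewrite /convolution szu.
have [|szu cE] := glue p1 p2.
  rewrite first_track_rcons second_track_rcons !size_cat !szo.
  case/orP: xN => xs; [have := p1 xs|have := p2 xs]; rewrite xs.
    by case: (val x).2 p2 => [b|] //= p2; lia.
  by case: (val x).1 p1 => [b|] //= p1; lia.
by rewrite /is_convolution cE map_rcons cu /convolution szu.
Qed.

(** Compatibility of [f] is asked on convolutions only; the check that the input is a convolution is
    added here once and for all. *)
Lemma regular_relation_intro (T S : finType) (R : set (seq T * seq T))
    (f : seq (pad_pair T) -> S) :
  (forall u v x, is_convolution (rcons u x) -> is_convolution (rcons v x) ->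
     f u = f v -> f (rcons u x) = f (rcons v x)) ->
  (forall u v, is_convolution u -> is_convolution v -> f u = f v ->
     R (first_track u, second_track u) -> R (first_track v, second_track v)) ->
  regular_relation R.
Proof.
move=> fS fR; apply/regular_relationE/regular_languageP.
(* [None] is a sink for words that are not convolutions. The two Booleans tell which tracks are
   still unpadded, and so which letters may follow. *)
pose F u := if `[< is_convolution u >] then
  Some (size (first_track u) == size u, size (second_track u) == size u, f u)
  else None.
have FP u v : F u = F v -> is_convolution u ->
    [/\ is_convolution v, size (first_track u) = size u ->
        size (first_track v) = size v, size (second_track u) = size u ->
        size (second_track v) = size v & f u = f v].
  move=> + cu; rewrite /F asboolT //; case: asboolP => // cv [E1 E2 fuv].
  by split=> // /eqP; rewrite ?E1 ?E2 => /eqP.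
exists (option (bool * bool * S))%type, F; split; last first.
  move=> u v Fuv [cu Ru]; have [cv _ _ fuv] := FP _ _ Fuv cu.
  by split=> //; exact: fR Ru.
have FC u v x : F u = F v -> is_convolution (rcons u x) ->
    is_convolution (rcons v x) /\ f u = f v.
  move=> Fuv /is_convolution_rcons[cu p1 p2].
  have [cv q1 q2 fuv] := FP _ _ Fuv cu; split=> //.
  by apply/is_convolution_rcons; split=> // [/p1|/p2].
move=> u v x Fuv; rewrite /F; case: asboolP => cu; case: asboolP => cv //.
- have [_ fuv] := FC _ _ _ Fuv cu; rewrite (fS _ _ _ cu cv fuv).
  have track (w : seq (pad_pair T)) : is_convolution (rcons w x) ->
      (size (first_track (rcons w x)) == size (rcons w x)) = (val x).1 /\
      (size (second_track (rcons w x)) == size (rcons w x)) = (val x).2.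
    move=> /is_convolution_rcons[_ p1 p2].
    rewrite first_track_rcons second_track_rcons !size_cat size_rcons.
    have := size_first_track w; have := size_second_track w.
    move=> q_le p_le; split.
      case: (val x).1 p1 => [a /(_ isT) ->|_] /=; first by rewrite addn1 eqxx.
      by rewrite addn0 ltn_eqF ?ltnS.
    case: (val x).2 p2 => [b /(_ isT) ->|_] /=; first by rewrite addn1 eqxx.
    by rewrite addn0 ltn_eqF ?ltnS.
  by have [-> ->] := track _ cu; have [-> ->] := track _ cv.
- by case: cv; have [] := FC _ _ _ Fuv cu.
- by case: cu; have [] := FC _ _ _ (esym Fuv) cv.
Qed.

Lemma regular_relation_setI (T : finType) (R S : set (seq T * seq T)) :
  regular_relation R -> regular_relation S -> regular_relation (R `&` S).
Proof.
move=> /regular_relationE rR /regular_relationE rS; apply/regular_relationE.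
rewrite [X in regular_language X](_ : _ =
  [set u | is_convolution u /\ R (first_track u, second_track u)] `&`
  [set u | is_convolution u /\ S (first_track u, second_track u)]).
  exact: regular_setI.
by apply/seteqP; split=> u /= => [[cu [Ru Su]]|[[cu Ru] [_ Su]]].
Qed.

Lemma regular_relation_first (T : finType) (L : set (seq T)) :
  regular_language L ->
  regular_relation [set p : seq T * seq T | L p.1].
Proof.
move=> /(regular_preimage_pmap (fun x : pad_pair T => (val x).1)).
move=> /regular_languageP[S [f [fS fL]]].
apply: (@regular_relation_intro _ _ _ f) => [u v x _ _|u v _ _]; first exact: fS.
exact: fL.
Qed.

Lemma regular_relation_second (T : finType) (L : set (seq T)) :
  regular_language L ->
  regular_relation [set p : seq T * seq T | L p.2].
Proof.
move=> /(regular_preimage_pmap (fun x : pad_pair T => (val x).2)).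
move=> /regular_languageP[S [f [fS fL]]].
apply: (@regular_relation_intro _ _ _ f) => [u v x _ _|u v _ _]; first exact: fS.
exact: fL.
Qed.

(** The length condition keeps the second track free of padding, so projecting a convolution to it
    gives [map Some v], with no trailing padding to strip. *)
Lemma regular_projection (T : finType) (R : set (seq T * seq T)) :
  (forall p, R p -> size p.1 <= size p.2) ->
  regular_relation R -> regular_language [set v | exists w, R (w, v)].
Proof.
move=> Rsize /(regular_image_map (fun x : pad_pair T => (val x).2)).
move=> /(regular_preimage_map (@Some T)).
congr regular_language; apply/seteqP; split=> v /=.
  move=> [u [[p q] Rpq /= uE] uv]; exists p.
  have [_ uq] := convolution_tracks uE.
  suff -> : v = q by [].
  rewrite -uq -[v](@map_pK _ _ id (@Some T)) // -uv.
  by elim: (u) => //= x s ->.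
move=> [w Rwv]; have [u uE] := convolution_exists w v.
exists u; first by exists (w, v).
rewrite (map_comp snd val) uE /convolution (maxn_idPr (Rsize _ Rwv)) /mkseq.
rewrite -map_comp -[RHS](mkseq_nth None) size_map.
by apply: eq_map => k /=; rewrite -onthE.
Qed.

(** * Shortlex order *)

(* The value of a word read in base #|T| + 2 with a leading digit 1: comparing
   these values is comparing words in the shortlex order. *)
Definition shortlex_rank (T : finType) (w : seq T) : nat :=
  foldl (fun n x => n * #|T|.+2 + enum_rank x) 1 w.

Lemma shortlex_rank_rcons (T : finType) (w : seq T) x :
  shortlex_rank (rcons w x) = shortlex_rank w * #|T|.+2 + enum_rank x.
Proof. exact: foldl_rcons. Qed.

(** As the base is at least 2, even for an empty alphabet, these intervals are disjoint for
    different lengths, so longer words have larger rank. *)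
Lemma shortlex_rank_bounds (T : finType) (w : seq T) :
  #|T|.+2 ^ size w <= shortlex_rank w < 2 * #|T|.+2 ^ size w.
Proof.
elim/last_ind: w => [//|w x]; rewrite shortlex_rank_rcons size_rcons expnSr.
move: (shortlex_rank w) (_ ^ _) => r p /andP[pr rp].
have x_lt : enum_rank x < #|T|.+2 by do 2!apply: leqW; exact: ltn_ord.
rewrite (leq_trans _ (leq_addr _ _)) ?leq_mul2r ?pr ?orbT //=.
apply: (@leq_trans (r.+1 * #|T|.+2)); first by rewrite mulSnr ltn_add2l.
by rewrite mulnA leq_mul2r rp orbT.
Qed.

Lemma ltn_shortlex_rank_size (T : finType) (v w : seq T) :
  size v < size w -> shortlex_rank v < shortlex_rank w.
Proof.
move=> vw; have /andP[_ v_lt] := shortlex_rank_bounds v.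
have /andP[w_ge _] := shortlex_rank_bounds w.
apply: leq_trans v_lt _; apply: leq_trans _ w_ge.
apply: leq_trans (_ : #|T|.+2 ^ (size v).+1 <= _); first by rewrite expnS leq_mul.
by rewrite leq_exp2l.
Qed.

(** Equal ranks force equal lengths; then division by the base splits off the last digit. *)
Lemma shortlex_rank_inj (T : finType) : injective (@shortlex_rank T).
Proof.
move=> v w vw; have szvw : size v = size w.
  have [/ltn_shortlex_rank_size|/ltn_shortlex_rank_size|//] :=
    ltngtP (size v) (size w); by rewrite vw ltnn.
elim/last_ind: v w szvw vw => [|v x IH] w; first by case: w.
case/lastP: w => [|w y]; rewrite !size_rcons // => -[szvw].
rewrite !shortlex_rank_rcons => vw.
have small (z : T) : enum_rank z < #|T|.+2 by do 2!apply: leqW; exact: ltn_ord.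
have /(congr1 (divn^~ #|T|.+2)) := vw.
rewrite !divnMDl // !divn_small // !addn0 => rvw.
move: vw; rewrite rvw => /addnI/val_inj/enum_rank_inj ->.
by rewrite (IH w).
Qed.

(** The automaton only remembers whether the first rank is so far smaller than, equal to or larger
    than the second. *)
Lemma regular_relation_shortlex (T : finType) :
  regular_relation
    [set p : seq T * seq T | shortlex_rank p.1 < shortlex_rank p.2].
Proof.
apply: (@regular_relation_intro _ _ _ (fun u =>
  (shortlex_rank (first_track u) < shortlex_rank (second_track u),
   shortlex_rank (first_track u) == shortlex_rank (second_track u)))); last first.
  by move=> u v _ _ [lt_uv _]; rewrite /= lt_uv.
(* If only one track grows, it becomes strictly longer than the other and length decides. If both
   grow, the new digits matter only when the ranks were equal. *)
have step (u : seq (pad_pair T)) x : is_convolution (rcons u x) ->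
  let n := shortlex_rank (first_track u) in
  let m := shortlex_rank (second_track u) in
  (shortlex_rank (first_track (rcons u x))
     < shortlex_rank (second_track (rcons u x)) =
   match (val x).1, (val x).2 with
   | Some a, Some b =>
     (n < m) || (n == m) && (enum_rank a < enum_rank b)
   | None, Some _ => true
   | _, None => false
   end) /\
  (shortlex_rank (first_track (rcons u x))
     == shortlex_rank (second_track (rcons u x)) =
   match (val x).1, (val x).2 with
   | Some a, Some b => (n == m) && (enum_rank a == enum_rank b :> nat)
   | _, _ => false
   end).
  move=> /is_convolution_rcons[_ p1 p2] n m.
  have pu := size_first_track u; have qu := size_second_track u.
  have : (val x).1 || (val x).2 by case: (x) => -[[a|] [b|]].
  rewrite first_track_rcons second_track_rcons.
  case: (val x).1 p1 => [a /(_ isT) p1|_];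
    case: (val x).2 p2 => [b /(_ isT) p2|_] //= _;
    rewrite ?cats0 ?cats1 ?shortlex_rank_rcons -/n -/m.
  - have small (z : T) : enum_rank z < #|T|.+2 by do 2!apply: leqW; exact: ltn_ord.
    have carry (i j r s : nat) : i < #|T|.+2 -> r < s ->
        r * #|T|.+2 + i < s * #|T|.+2 + j.
      move=> iB rs; apply: (@leq_trans (r.+1 * #|T|.+2)).
        by rewrite mulSnr ltn_add2l.
      by apply: leq_trans (leq_addr _ _); rewrite leq_mul2r rs orbT.
    case: (ltngtP n m) => [nm|mn|->] /=; last by rewrite ltn_add2l eqn_add2l.
      by have h := carry _ (enum_rank b) _ _ (small a) nm; rewrite h ltn_eqF.
    have h := carry _ (enum_rank a) _ _ (small b) mn.
    by rewrite ltnNge (ltnW h) gtn_eqF.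
  - have : m < shortlex_rank (rcons (first_track u) a).
      by apply: ltn_shortlex_rank_size; rewrite size_rcons p1.
    by rewrite shortlex_rank_rcons -/n => h; rewrite gtn_eqF // ltnNge ltnW.
  - have : n < shortlex_rank (rcons (second_track u) b).
      by apply: ltn_shortlex_rank_size; rewrite size_rcons p2.
    by rewrite shortlex_rank_rcons -/m => h; rewrite ltn_eqF // h.
move=> u v x cu cv [lt_uv eq_uv].
have [-> ->] := step u x cu; have [-> ->] := step v x cv.
by rewrite lt_uv eq_uv.
Qed.

(** * Word differences *)

Definition word_diff (G : groupType) (A : seq G) (v w : seq (letter A)) : G :=
  ((word_eval v)^-1 * word_eval w)%g.

Lemma word_eval_cat (G : groupType) (A : seq G) (v w : seq (letter A)) :
  word_eval (v ++ w) = (word_eval v * word_eval w)%g.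
Proof. exact: big_cat. Qed.

Lemma word_eval_nil (G : groupType) (A : seq G) :
  word_eval (nil : seq (letter A)) = 1%g.
Proof. exact: big_nil. Qed.

Lemma word_eval_cons (G : groupType) (A : seq G) x (w : seq (letter A)) :
  word_eval (x :: w) = (val x * word_eval w)%g.
Proof. exact: big_cons. Qed.

Lemma word_diff_cat (G : groupType) (A : seq G) (v v' w w' : seq (letter A)) :
  word_diff (v ++ v') (w ++ w') =
  ((word_eval v')^-1 * word_diff v w * word_eval w')%g.
Proof. by rewrite /word_diff !word_eval_cat !gnorm. Qed.

(** The state is the current difference, an element of the finite set [F], or [None] once a
    difference has left [F]. Reading letters [x] and [y] turns the difference [d] into [x^-1 d y],
    with padding read as 1, so nothing else need be stored. *)
Lemma regular_relation_word_diff (G : groupType) (A : seq G) (F : seq G) (g : G) :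
  regular_relation [set p : seq (letter A) * seq (letter A) |
    (forall k, word_diff (take k p.1) (take k p.2) \in F) /\
    word_diff p.1 p.2 = g].
Proof.
pose D u := word_diff (first_track u) (second_track u : seq (letter A)).
pose C u := forall k, word_diff (take k (first_track u))
  (take k (second_track u : seq (letter A))) \in F.
have CD u : C u -> D u \in F.
  move=> /(_ (size u)).
  by rewrite !take_oversize ?size_first_track ?size_second_track.
(* Prefixes of length at most [size u] do not see the new letter and longer ones are the full
   tracks, so just one new difference has to be tested. *)
have CR u x : is_convolution (rcons u x) ->
    (C (rcons u x) <-> C u /\ D (rcons u x) \in F).
  move=> /is_convolution_rcons[_ p1 p2].
  have take_le k : k <= size u ->
    take k (first_track (rcons u x)) = take k (first_track u) /\
    take k (second_track (rcons u x)) = take k (second_track u).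
    move=> ku; rewrite first_track_rcons second_track_rcons.
    by rewrite !(take_cat_opt (n := size u)).
  have take_gt k : size u < k ->
    take k (first_track (rcons u x)) = first_track (rcons u x) /\
    take k (second_track (rcons u x)) = second_track (rcons u x).
    rewrite -(size_rcons u x) => ku; split; rewrite take_oversize //.
      exact: leq_trans (size_first_track _) ku.
    exact: leq_trans (size_second_track _) ku.
  split=> [CC|[Cu Dux] k]; last first.
    by case: (leqP k (size u)) => [/take_le|/take_gt] [-> ->].
  split=> [k|]; last exact: CD.
  have [ku|uk] := leqP k (size u).
    by have := CC k; have [-> ->] := take_le k ku.
  have := CC (size u); have [-> ->] := take_le _ (leqnn (size u)).
  have szk : size (first_track u) <= k := leq_trans (size_first_track _) (ltnW uk).
  have szk' : size (second_track u) <= k := leq_trans (size_second_track _) (ltnW uk).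
  by rewrite !take_oversize ?size_first_track ?size_second_track.
pose f u : option (seq_sub F) := if `[< C u >] then insub (D u) else None.
have fP u v : f u = f v -> C u -> C v /\ D u = D v.
  move=> + Cu; rewrite /f asboolT // insubT ?CD // => DuF.
  case: asboolP => // Cv; rewrite insubT ?CD // => DvF.
  by move=> /(congr1 (omap val)) [DE].
have fE u : C u \/ f u = None.
  by rewrite /f; case: asboolP; [left|right].
apply: (@regular_relation_intro _ _ _ f) => [u v x cu cv fuv|u v cu cv fuv].
  have H (w w' : seq (pad_pair (letter A))) : f w = f w' ->
    is_convolution (rcons w x) -> is_convolution (rcons w' x) ->
    C (rcons w x) -> C (rcons w' x) /\ D (rcons w x) = D (rcons w' x).
    move=> fw cw cw' /(CR _ _ cw)[Cw Dw]; have [Cw' Dww'] := fP _ _ fw Cw.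
    have DE : D (rcons w x) = D (rcons w' x).
      by rewrite /D !first_track_rcons !second_track_rcons !word_diff_cat -/(D _) Dww'.
    by split=> //; apply/(CR _ _ cw'); rewrite -DE.
  rewrite /f; case: asboolP => Cu; case: asboolP => Cv //.
  - by have [_ ->] := H _ _ fuv cu cv Cu.
  - by case: Cv; have [] := H _ _ fuv cu cv Cu.
  - by case: Cu; have [] := H _ _ (esym fuv) cv cu Cv.
by move=> [Cu Du]; have [Cv Duv] := fP _ _ fuv Cu; split=> //; rewrite -Du; exact/esym.
Qed.

(** * Fellow travelling *)

(** Which continuations of [u] lead into [L] depends only on the state after [u]. One continuation
    is chosen for each state that has any, and [c] is the largest of their lengths. *)
Lemma regular_completion (T : finType) (L : set (seq T)) :
  regular_language L ->
  exists c, forall u x, L (u ++ x) -> exists2 y, size y <= c & L (u ++ y).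
Proof.
move=> /regular_languageP[S [f [fS fL]]].
have fcat u v x : f u = f v -> f (u ++ x) = f (v ++ x).
  move=> fuv; elim/last_ind: x => [|x a IH]; first by rewrite !cats0.
  by rewrite -!rcons_cat; exact: fS.
pose P s y := exists2 u, f u = s & L (u ++ y).
pose len s := if pselect (exists y, P s y) is left ex
  then size (projT1 (cid ex)) else 0.
exists (\max_s len s) => u x Lux.
have := leq_bigmax (F := len) (f u); rewrite {1}/len.
case: pselect => [ex|[]]; last by exists x, u.
case: (cid ex) => y /= [v fvu Lvy] y_le; exists y => //.
exact: fL (fcat _ _ _ fvu) Lvy.
Qed.

Lemma take_convolution (T : Type) (v w : seq T) (k : nat) :
  take k (convolution v w) = convolution (take k v) (take k w).
Proof.
rewrite /convolution /mkseq -map_take take_iota.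
have -> : maxn (size (take k v)) (size (take k w)) =
  minn k (maxn (size v) (size w)) by rewrite !size_take_min; lia.
apply/eq_in_map => i; rewrite mem_iota leq_min => /andP[_ /andP[ik _]].
by rewrite !onthE !map_take !nth_take.
Qed.

(** The convolution cut after [k] symbols is completed within the regular language of convolutions;
    the tracks of the completion are [v'] and [w']. *)
Lemma regular_relation_completion (T : finType) (R : set (seq T * seq T)) :
  regular_relation R ->
  exists c, forall v w k, R (v, w) -> exists v' w',
    [/\ size v' <= c, size w' <= c & R (take k v ++ v', take k w ++ w')].
Proof.
move=> /regular_relationE/regular_completion[c cP]; exists c => v w k Rvw.
have [u uE] := convolution_exists v w.
have [uv uw] := convolution_tracks uE.
have [tv tw] : first_track (take k u) = take k v /\
    second_track (take k u) = take k w.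
  by apply: convolution_tracks; rewrite map_take uE take_convolution.
have [] := cP (take k u) (drop k u).
  by rewrite cat_take_drop /= /is_convolution uv uw.
move=> x xc [_]; rewrite /first_track /second_track !pmap_cat.
rewrite -!/(first_track _) -!/(second_track _) tv tw => Rx.
exists (first_track x), (second_track x); split=> //.
  exact: leq_trans (size_first_track _) xc.
exact: leq_trans (size_second_track _) xc.
Qed.

(** * Balls around the identity and the Cayley distance *)

Definition ball (G : groupType) (A : seq G) (n : nat) : set G :=
  [set g | exists2 w : seq (letter A), size w <= n & word_eval w = g].

Lemma ballW (G : groupType) (A : seq G) (m n : nat) g :
  m <= n -> ball A m g -> ball A n g.
Proof. by move=> mn [w wm <-]; exists w => //; exact: leq_trans mn. Qed.

Lemma ball_one (G : groupType) (A : seq G) (n : nat) : ball A n 1%g.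
Proof. by exists [::] => //; rewrite word_eval_nil. Qed.

Lemma ball_mul (G : groupType) (A : seq G) (m n : nat) g h :
  ball A m g -> ball A n h -> ball A (m + n) (g * h)%g.
Proof.
move=> [v vm <-] [w wn <-]; exists (v ++ w); last exact: word_eval_cat.
by rewrite size_cat leq_add.
Qed.

Lemma letterP (G : groupType) (A : seq G) (x : letter A) :
  val x \in A \/ (val x)^-1%g \in A.
Proof.
have := valP x; rewrite mem_cat => /orP[|/mapP[a aA ->]]; first by left.
by right; rewrite invgK.
Qed.

Lemma ball_letter (G : groupType) (A : seq G) a : a \in A -> ball A 1 a.
Proof.
move=> aA; have aAV : a \in A ++ [seq (b^-1)%g | b <- A] by rewrite mem_cat aA.
by exists [:: SeqSub aAV]; rewrite // word_eval_cons word_eval_nil mulg1.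
Qed.

Lemma ball_letterV (G : groupType) (A : seq G) a : a \in A -> ball A 1 a^-1%g.
Proof.
move=> aA; have aAV : a^-1%g \in A ++ [seq (b^-1)%g | b <- A].
  by rewrite mem_cat; apply/orP; right; exact: map_f.
by exists [:: SeqSub aAV]; rewrite // word_eval_cons word_eval_nil mulg1.
Qed.

Lemma ball_inv (G : groupType) (A : seq G) (n : nat) g :
  ball A n g -> ball A n g^-1%g.
Proof.
move=> [w wn <-]; elim: w n wn => [|x w IH] n.
  by move=> _; rewrite word_eval_nil invg1; exact: ball_one.
case: n => // n /IH wn; rewrite word_eval_cons invgM -addn1.
apply: ball_mul => //; case: (letterP x) => [/ball_letterV //|/ball_letter].
by [].
Qed.

(** This finiteness is what lets word differences serve as states of an automaton. *)
Lemma ball_finite (G : groupType) (A : seq G) (n : nat) :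
  exists F : seq G, forall g, ball A n g -> g \in F.
Proof.
exists [seq word_eval (val w) | w <- enum {: n.-bseq (letter A)}] => g [w wn <-].
by apply/mapP; exists (Bseq wn); rewrite ?mem_enum.
Qed.

Lemma cayley_walkP (G : groupType) (A : seq G) (g h : G) (n : nat) :
  cayley_walk A g h n <->
  exists2 w : seq (letter A), size w = n & (g * word_eval w)%g = h.
Proof.
split=> [[p [<- pth <-]]|[w <- <-]].
  elim: p g pth => [|x p IH] g /=.
    by move=> _; exists [::]; rewrite // word_eval_nil mulg1.
  move=> /andP[/hasP[a aA gx] /IH[w szw <-]].
  have [y yE] : exists y : letter A, x = (g * val y)%g.
    case/orP: gx => /eqP ->.
      have aL : a \in A ++ [seq (b^-1)%g | b <- A] by rewrite mem_cat aA.
      by exists (SeqSub aL).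
    have aL : a^-1%g \in A ++ [seq (b^-1)%g | b <- A].
      by rewrite mem_cat; apply/orP; right; exact: map_f.
    by exists (SeqSub aL); rewrite /= mulgK.
  by exists (y :: w); rewrite /= ?szw // word_eval_cons yE mulgA.
elim: w g => [|x w IH] g /=.
  by exists [::]; rewrite word_eval_nil mulg1.
have [p [szp pth lst]] := IH (g * val x)%g.
exists ((g * val x)%g :: p); split=> /=; first by rewrite szp.
  rewrite pth andbT; apply/hasP.
  case: (letterP x) => xA; first by exists (val x); rewrite ?eqxx.
  by exists (val x)^-1%g; rewrite // mulgK eqxx orbT.
by rewrite lst word_eval_cons mulgA.
Qed.

Lemma cayley_dist_ball (G : groupType) (A : seq G) (g h : G) (n : nat) :
  generates A -> cayley_dist A g h <= n -> ball A n (g^-1 * h)%g.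
Proof.
move=> genA; rewrite /cayley_dist; case: pselect => [ex|[]]; last first.
  (* A word for [g^-1 h] gives a walk, which rules out the default value 0 of the distance. *)
  have [w wE] := genA (g^-1 * h)%g; exists (size w); apply/asboolP.
  by apply/cayley_walkP; exists w; rewrite // wE mulgA mulgV mul1g.
case: ex_minnP => m /asboolP/cayley_walkP[w <- <-] _ wn.
by exists w; rewrite // mulgA mulVg mul1g.
Qed.

Lemma cayley_dist_refl (G : groupType) (A : seq G) (g : G) :
  cayley_dist A g g = 0.
Proof.
rewrite /cayley_dist; case: pselect => // ex.
case: ex_minnP => m _ m_min; apply/eqP; rewrite -leqn0; apply: m_min.
by apply/asboolP; exists [::].
Qed.

(** * Fellow travelling for representations at bounded distance from evaluation *)

Section BoundedDeviation.
Variables (G : groupType) (A : seq G).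
Variables (L : set (seq (letter A))) (psi : seq (letter A) -> G) (C : nat).
Hypotheses (rep : cayley_automatic_rep L psi).
Hypothesis dev : forall w, L w -> ball A C ((word_eval w)^-1 * psi w)%g.

(* A short completion of the prefixes of a pair in the relation of a is again
   in that relation, so its endpoints are close, hence so are the prefixes. *)
Lemma edge_fellow_travel a : a \in A ->
  exists K, forall v w, L v -> L w -> psi w = (psi v * a)%g ->
    forall k, ball A K (word_diff (take k v) (take k w)).
Proof.
move=> aA; have [_ _ /(_ _ aA)/regular_relation_completion[c cP]] := rep.
(* Each [c] pays for undoing one completion, each [C] for passing between evaluation and [psi] at
   one endpoint, and 1 for the generator [a]. *)
exists (c + (C + 1 + C) + c) => v w Lv Lw vw k.
have [|v' [w' [v'c w'c [_ [/= Lv' <- Lw' vw']]]]] := cP v w k.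
  by exists (psi v).
have -> : word_diff (take k v) (take k w) =
  (word_eval v' * word_diff (take k v ++ v') (take k w ++ w')
    * (word_eval w')^-1)%g by rewrite word_diff_cat !gnorm.
apply: ball_mul; last by apply: ball_inv; exists w'.
apply: ball_mul; first by exists v'.
set V := _ ++ v'; set W := _ ++ w'.
have -> : word_diff V W =
    ((word_eval V)^-1 * psi V * a * ((word_eval W)^-1 * psi W)^-1)%g.
  by rewrite vw' /word_diff !gnorm.
apply: ball_mul; last by apply: ball_inv; exact: dev.
by apply: ball_mul; [exact: dev|exact: ball_letter].
Qed.

(** Inverse letters come for free: exchanging the two words inverts their differences, and balls are
    closed under inversion. The constant is a maximum over [A]. *)
Lemma letter_fellow_travel :
  exists K, forall v w (x : letter A), L v -> L w -> psi w = (psi v * val x)%g ->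
    forall k, ball A K (word_diff (take k v) (take k w)).
Proof.
have /choice[K KP] : forall a, exists K, a \in A ->
    forall v w, L v -> L w -> psi w = (psi v * a)%g ->
    forall k, ball A K (word_diff (take k v) (take k w)).
  move=> a; case: (boolP (a \in A)) => [/edge_fellow_travel[K KP]|_].
    by exists K.
  by exists 0.
exists (\max_(a <- A) K a) => v w x Lv Lw vw k.
have [xA|xA] := letterP x.
  by apply: ballW (KP _ xA _ _ Lv Lw vw k); exact: leq_bigmax_seq.
have wv : psi v = (psi w * (val x)^-1)%g by rewrite vw mulgK.
have -> : word_diff (take k v) (take k w) = (word_diff (take k w) (take k v))^-1%g.
  by rewrite /word_diff !gnorm.
by apply: ball_inv; apply: ballW (KP _ xA _ _ Lw Lv wv k); exact: leq_bigmax_seq.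
Qed.

(** A word [u] from [psi v] to [psi w] is followed letter by letter. Surjectivity of [psi] provides
    a word of [L] at each vertex on the way, each step adds [K], and injectivity identifies the last
    word with [w]. *)
Lemma ball_fellow_travel n :
  exists K, forall v w, L v -> L w -> ball A n ((psi v)^-1 * psi w)%g ->
    forall k, ball A K (word_diff (take k v) (take k w)).
Proof.
have [_ [_ psi_inj psi_surj] _] := rep.
have [K KP] := letter_fellow_travel.
exists (n * K) => v w Lv Lw [u un uE] k.
apply: (@ballW _ _ (size u * K)); first by rewrite leq_mul2r un orbT.
elim: u v Lv {un} uE => [|x u IH] v Lv uE.
  have -> : v = w.
    apply: psi_inj; rewrite ?inE // -[RHS](mulVKg (psi v)) -uE.
    by rewrite word_eval_nil mulg1.
  by rewrite /word_diff mulVg; exact: ball_one.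
have [z Lz zE] : exists2 z, L z & psi z = (psi v * val x)%g by exact: psi_surj.
have -> : word_diff (take k v) (take k w) =
    (word_diff (take k v) (take k z) * word_diff (take k z) (take k w))%g.
  by rewrite /word_diff !gnorm.
rewrite /= mulSn; apply: ball_mul; first exact: (KP v z x).
apply: IH => //; rewrite zE invgM -mulgA -uE word_eval_cons.
by rewrite mulKg.
Qed.

(** If [psi w = g], the error between the value of [w] and [g] is spelled by at most [C] letters;
    appending them to [w] corrects it. *)
Lemma suffix_extension_surj g :
  exists2 v, suffix_extension C L v & word_eval v = g.
Proof.
have [_ [_ _ /(_ g I)[w Lw <-]] _] := rep.
have [u uC uE] := dev Lw; exists (w ++ u); first by exists w, u.
by rewrite word_eval_cat uE mulgA mulgV mul1g.
Qed.

Lemma suffix_extension_fellow_travel :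
  exists K, forall v w, suffix_extension C L v -> suffix_extension C L w ->
    ball A 1 (word_diff v w) ->
    forall k, ball A K (word_diff (take k v) (take k w)).
Proof.
(* The path from [psi v] to [psi w] runs through the values of [v], [v ++ v'], [w ++ w'] and [w]:
   four legs of length at most [C] and a middle one of length at most 1. *)
have [K KP] := ball_fellow_travel (C + C + 1 + (C + C)).
(* A prefix of [v ++ v'] is a prefix of [v] followed by at most [C] letters, and likewise for [w];
   this gives the outer terms. *)
exists (C + K + C) => _ _ [v [v' [Lv v'C ->]]] [w [w' [Lw w'C ->]]] vw k.
have take_suffix (u u' : seq (letter A)) : size u' <= C ->
    exists2 s, size s <= C & take k (u ++ u') = take k u ++ s.
  move=> u'C; rewrite take_cat; case: ltnP => ku; first by exists [::]; rewrite ?cats0.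
  exists (take (k - size u) u'); last by rewrite (take_oversize ku).
  by rewrite (leq_trans _ u'C) // size_take_min geq_minr.
have [s sC ->] := take_suffix v v' v'C; have [t tC ->] := take_suffix w w' w'C.
rewrite word_diff_cat; apply: ball_mul; last by exists t.
apply: ball_mul; first by apply: ball_inv; exists s.
apply: KP => //.
have -> : ((psi v)^-1 * psi w)%g =
    (((word_eval v)^-1 * psi v)^-1 * word_eval v' * word_diff (v ++ v') (w ++ w')
     * ((word_eval w')^-1 * ((word_eval w)^-1 * psi w)))%g.
  by rewrite word_diff_cat /word_diff !gnorm.
apply: ball_mul; last by apply: ball_mul; [apply: ball_inv; exists w'|exact: dev].
apply: ball_mul => //; apply: ball_mul; last by exists v'.
by apply: ball_inv; exact: dev.
Qed.

End BoundedDeviation.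

(** * The shortlex automatic structure *)

Lemma automatic_of_fellow_travel (G : groupType) (A : seq G)
    (L : set (seq (letter A))) (F : seq G) :
  regular_language L ->
  (forall g, exists2 v, L v & word_eval v = g) ->
  (forall v w, L v -> L w -> ball A 1 (word_diff v w) ->
     forall k, word_diff (take k v) (take k w) \in F) ->
  exists M : set (seq (letter A)), cayley_automatic_rep M (@word_eval G A).
Proof.
move=> regL surjL FP.
pose smaller := [set p : seq (letter A) * seq (letter A) |
    shortlex_rank p.1 < shortlex_rank p.2] `&`
  ([set p | L p.1] `&` ([set p | L p.2] `&`
   [set p | (forall k, word_diff (take k p.1) (take k p.2) \in F) /\
            word_diff p.1 p.2 = 1%g])).
(* Words with equal values have difference 1, which lies in the unit ball, so fellow travelling
   holds and [smaller] detects every such pair. *)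
have smallerP v w : L v -> L w -> word_eval v = word_eval w ->
    shortlex_rank v < shortlex_rank w -> smaller (v, w).
  move=> Lv Lw vw lt_vw.
  have vw1 : word_diff v w = 1%g by rewrite /word_diff vw mulVg.
  do 4!split=> //; apply: FP => //; rewrite vw1; exact: ball_one.
pose M := L `&` ~` [set v | exists w, smaller (w, v)].
have regM : regular_language M.
  (* The shortlex-smaller word is never longer, as the projection requires. *)
  apply: regular_setI => //; apply: regular_setC; apply: regular_projection.
    move=> p [lt_p _]; rewrite leqNgt; apply/negP => /ltn_shortlex_rank_size.
    by rewrite ltnNge ltnW.
  apply: regular_relation_setI; first exact: regular_relation_shortlex.
  apply: regular_relation_setI; first exact: regular_relation_first.
  apply: regular_relation_setI; first exact: regular_relation_second.
  exact: regular_relation_word_diff.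
exists M; split=> //.
  split=> [//|v w|g _].
    rewrite !inE => -[Lv Nv] [Lw Nw] vw; apply: shortlex_rank_inj.
    have [lt_vw|lt_wv|//] := ltngtP (shortlex_rank v) (shortlex_rank w).
      by case: Nw; exists v; exact: smallerP.
    by case: Nv; exists w; exact: smallerP.
  have ex : exists n, `[< exists v, [/\ L v, word_eval v = g & shortlex_rank v = n] >].
    have [v Lv vg] := surjL g.
    by exists (shortlex_rank v); apply/asboolP; exists v.
  case: (ex_minnP ex) => n /asboolP[v [Lv vg vn]] n_min; exists v => //.
  split=> // -[w [/= lt_wv [Lw [_ [_ wv1]]]]].
  have : n <= shortlex_rank w.
    apply: n_min; apply/asboolP; exists w; split=> //.
    by rewrite -vg; apply/esym/eqP; rewrite -(mulg1 (word_eval w)) -wv1 mulVKg.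
  by rewrite -vn leqNgt lt_wv.
move=> a aA.
(* On [M] a pair with difference [a] fellow travels automatically, so adding that condition leaves
   the relation unchanged and makes it recognizable by word differences. *)
rewrite [X in regular_relation X](_ : _ = [set p | M p.1] `&` ([set p | M p.2] `&`
   [set p | (forall k, word_diff (take k p.1) (take k p.2) \in F) /\
            word_diff p.1 p.2 = a])).
  apply: regular_relation_setI; first exact: regular_relation_first.
  apply: regular_relation_setI; first exact: regular_relation_second.
  exact: regular_relation_word_diff.
apply/seteqP; split=> -[v w] /=.
  move=> [_ [Mv <- Mw vw]].
  have vwa : word_diff v w = a by rewrite /word_diff vw mulKg.
  do 3!split=> //; apply: FP; rewrite ?vwa; [exact: Mv.1|exact: Mw.1|].
  exact: ball_letter.
move=> [Mv [Mw [_ vwa]]]; exists (word_eval v); split=> //.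
by rewrite -vwa /word_diff mulVKg.
Qed.

Lemma automatic_of_bounded_deviation (G : groupType) (A : seq G)
    (L : set (seq (letter A))) (psi : seq (letter A) -> G) (C : nat) :
  generates A -> cayley_automatic_rep L psi ->
  (forall w, L w -> cayley_dist A (word_eval w) (psi w) <= C) ->
  automatic G.
Proof.
move=> genA rep devC.
have dev w : L w -> ball A C ((word_eval w)^-1 * psi w)%g.
  by move=> /devC; exact: cayley_dist_ball.
have [K KP] := suffix_extension_fellow_travel rep dev.
have [F FP] := ball_finite A K.
exists A; split=> //; apply: (@automatic_of_fellow_travel _ _ (suffix_extension C L) F).
- by apply: regular_suffix_extension; case: rep.
- exact: suffix_extension_surj rep dev.
- by move=> v w Lv Lw vw k; apply: FP; exact: KP.
Qed.

(** * Bounded functions and automatic groups *)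

Lemma class_B_bounded_automatic (R : realType) (d : pfun R) (G : groupType) :
  in_frakF d -> pf_bounded d -> class_B d G -> automatic G.
Proof.
move=> [[Q Q0 domd] d_ge0 _] [B dB].
move=> [_ [A [genA [L [psi [rep [K [M [N [K0 M0 N0 dom le_hd]]]]]]]]]].
(* Distances are natural numbers, so the real bound [K * B] may be truncated. *)
apply: (@automatic_of_bounded_deviation _ _ L psi (Num.truncn (K%:R * B)%R)) => //.
(* This [n] is large enough for the comparison with [d] and for [w] to enter the maximum. *)
move=> w Lw; pose n := maxn N (size w).
have [Nn wn] : N <= n /\ size w <= n by rewrite leq_maxl leq_maxr.
have [_ dn] := dom n Nn.
have dMn : pf_dom d (M * n).
  by move: dn; rewrite domd => /leq_trans; apply; exact: leq_pmull.
apply: leq_trans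
  (@leq_bigmax_cond _ (fun v : n.-bseq _ => `[< L v >])
    (fun v => cayley_dist A (word_eval v) (psi v)) (Bseq wn) _) _.
  exact/asboolP.
rewrite Num.Theory.truncn_ge_nat; last first.
  by rewrite Num.Theory.mulr_ge0 // (Order.POrderTheory.le_trans _ (dB _ dn)) // d_ge0.
apply: Order.POrderTheory.le_trans (le_hd n Nn) _.
by rewrite Num.Theory.ler_wpM2l // dB.
Qed.

(** When [psi] is evaluation itself the deviation is 0, which lies below every nonnegative
    function. *)
Lemma automatic_class_B (R : realType) (d : pfun R) (G : groupType) :
  in_frakF d -> automatic G -> class_B d G.
Proof.
move=> [[Q Q0 domd] d_ge0 _] [A [genA [L rep]]]; split.
  by exists A; split=> //; exists L, (@word_eval G A).
exists A; split=> //; exists L, (@word_eval G A); split=> //.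
have [_ [_ _ /(_ 1%g I)[w Lw _]] _] := rep.
(* From [Q] on [d] is defined; from [(size w).+1] on [n] is positive and [w] witnesses that the
   deviation is defined. *)
exists 1, 1, (maxn Q (size w).+1); split=> // [|n|n].
- by rewrite leq_max Q0.
- rewrite /= geq_max => /andP[Qn wn]; split; last by rewrite domd.
  by split; [exact: leq_trans wn|exists w => //; exact: ltnW].
- rewrite geq_max => /andP[Qn _]; rewrite GRing.mul1r mul1n /=.
  rewrite big1 => [|v _]; last exact: cayley_dist_refl.
  by apply: d_ge0; rewrite domd.
Qed.

Theorem theorem9 (R : realType) :
  (forall d : pfun R,
     in_frakF d -> pf_bounded d -> (exists n, pf_dom d n /\ d n <> 0%R) ->
     forall G : groupType, finitely_generated G -> infinite_set [set: G]%classic ->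
       (class_B d G <-> automatic G)) /\
  (forall f : pfun R, in_frakF f ->
     (exists G : groupType,
        [/\ finitely_generated G, infinite_set [set: G]%classic,
            class_B f G & ~ automatic G]) ->
     ~ pf_bounded f).
Proof.
split=> [d dF dB _ G _ _|f fF [G [_ _ fG nautG]] fB].
  by split; [exact: class_B_bounded_automatic|exact: automatic_class_B].
exact/nautG/(class_B_bounded_automatic fF fB fG).
Qed.
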